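(* Let $\{\xi_v:v\in\{1,\dots,n\}^2\}$ be i.i.d. with law $\nu$ supported in $[0,\infty)$, and suppose that $\nu$ is continuous (has no atoms). For $k\in\{1,\dots,n-1\}$, the geodesic watermelons $\Gamma_n^k$ and $\Gamma_n^{k+1}$ interlace almost surely.
   Context: An upright path is a finite nearest-neighbour path in $\mathbb{Z}^2$ each of whose steps is $(1,0)$ or $(0,1)$; its weight is the sum of $\xi_v$ over its vertices, and the weight of a collection of disjoint upright paths is the sum of the weights of its members. A $k$-geodesic watermelon is a maximum weight collection of $k$ disjoint upright paths contained in $\{1,\dots,n\}^2$. When $\nu$ has no atoms, almost surely for every $k\in\{1,\dots,n\}$ there is a unique $k$-geodesic watermelon, denoted $\Gamma_n^k=(\Gamma^{k,1}_{n,\to},\dots,\Gamma^{k,k}_{n,\to})$, whose curves are such that $\Gamma^{k,i}_{n,\to}$ starts at $(1,k-i+1)$ and ends at $(n,n-i+1)$ for each $i$; its components are thereby listed from left to right. The time-range $\mathcal{R}(\gamma)$ of an upright path $\gamma$ is the interval of integers $t$ such that $x+y=t$ for some $(x,y)\in\gamma$; for such $t$ the point $(x,y)$ is unique and one writes $\gamma(t)=x-y$. For upright paths, $\gamma\preceq\phi$ means that $\mathcal{R}(\gamma)\cap\mathcal{R}(\phi)\ne\emptyset$ and $\gamma(t)\le\phi(t)$ for every $t$ in this intersection. A $k$-vector $\gamma$ and a $(k+1)$-vector $\gamma'$ whose components are upright paths interlace if $\gamma'_i\preceq\gamma_i\preceq\gamma'_{i+1}$ for $i\in\{1,\dots,k\}$.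 *)

(* Defs.v *)
From HB Require Import structures.
From mathcomp Require Import all_boot all_order all_algebra.
From mathcomp Require Import all_classical all_reals all_analysis.

Set Implicit Arguments.
Unset Strict Implicit.
Unset Printing Implicit Defensive.

Import Order.TTheory GRing.Theory Num.Theory.

Local Open Scope classical_set_scope.
Local Open Scope ring_scope.

Definition vertex : Type := (int * int)%type.

Definition box (n : nat) : pred vertex :=
  [pred v : vertex | (1 <= v.1 <= n%:Z) && (1 <= v.2 <= n%:Z)].

Definition upright_step : rel vertex :=
  [rel u v : vertex | (v == (u.1 + 1, u.2)) || (v == (u.1, u.2 + 1))].

(* A path is the list of its vertices, of which there is at least one. *)
Definition upright_path (p : seq vertex) : bool :=
  (p != [::]) && sorted upright_step p.

Definition path_weight (R : realType) (w : vertex -> R) (p : seq vertex) : R :=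
  \sum_(v <- p) w v.

Definition collection_weight (R : realType) (w : vertex -> R) (k : nat)
    (G : k.-tuple (seq vertex)) : R :=
  \sum_(i < k) path_weight w (tnth G i).

Definition disjoint_upright_paths (n k : nat) (G : k.-tuple (seq vertex)) : Prop :=
  [/\ forall i : 'I_k, upright_path (tnth G i),
      forall i : 'I_k, {subset tnth G i <= box n}
    & forall i j : 'I_k, i != j ->
        forall v : vertex, ~ (v \in tnth G i /\ v \in tnth G j)].

(* The competitors H have no prescribed endpoints. *)
Definition is_geodesic_watermelon (R : realType) (n : nat) (w : vertex -> R)
    (k : nat) (G : k.-tuple (seq vertex)) : Prop :=
  disjoint_upright_paths n G /\
  forall H : k.-tuple (seq vertex), disjoint_upright_paths n H ->
    collection_weight w H <= collection_weight w G.

(* With components numbered from 1, the i-th one runs from (1, k - i + 1) to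
   (n, n - i + 1); here i : 'I_k is numbered from 0.  The default value (0, 0)
   is never used on a nonempty path. *)
Definition left_to_right_endpoints (n k : nat) (G : k.-tuple (seq vertex)) : Prop :=
  forall i : 'I_k,
    head (0, 0) (tnth G i) = (1, k%:Z - i%:Z) /\
    last (0, 0) (tnth G i) = (n%:Z, n%:Z - i%:Z).

(* The watermelon Gamma_n^k in the environment w.  If there is none with these
   endpoints, its value is a tuple of empty lists, which interlaces with
   nothing when k > 0, as empty lists have empty time-ranges. *)
Definition geodesic_watermelon (R : realType) (n : nat) (w : vertex -> R)
    (k : nat) : k.-tuple (seq vertex) :=
  xget [tuple [::] | i < k]
    [set G : k.-tuple (seq vertex) |
      is_geodesic_watermelon n w G /\ left_to_right_endpoints n G].

Definition time (v : vertex) : int := v.1 + v.2.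

Definition time_range (p : seq vertex) : seq int := [seq time v | v <- p].

(* gamma(t) = x - y, where (x, y) is the vertex of gamma with x + y = t;
   meaningful for t in the time-range only. *)
Definition position (p : seq vertex) (t : int) : int :=
  let v := nth (0, 0) p (index t (time_range p)) in v.1 - v.2.

Definition path_preceq (p q : seq vertex) : Prop :=
  (exists t : int, t \in time_range p /\ t \in time_range q) /\
  forall t : int, t \in time_range p -> t \in time_range q ->
    position p t <= position q t.

(* [widen_ord (leqnSn k) i] and [lift ord0 i] are i and i + 1 in 'I_k.+1. *)
Definition interlace (k : nat) (G : k.-tuple (seq vertex))
    (G' : k.+1.-tuple (seq vertex)) : Prop :=
  forall i : 'I_k,
    path_preceq (tnth G' (widen_ord (leqnSn k) i)) (tnth G i) /\
    path_preceq (tnth G i) (tnth G' (lift ord0 i)).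

(* Mutual independence of the family (X v), v ranging over D. *)
Definition independent_on (R : realType) (d : measure_display)
    (T : measurableType d) (P : probability T R) (I : eqType) (D : pred I)
    (X : I -> {RV P >-> R}) : Prop :=
  forall (s : seq I) (B : I -> set R), uniq s -> {subset s <= D} ->
    (forall v, measurable (B v)) ->
    P [set x | forall v, v \in s -> B v (X v x)] =
      (\prod_(v <- s) P (X v @^-1` B v))%E.

(* Main.v *)
From HB Require Import structures.
Require Import Defs.
From mathcomp Require Import all_boot all_order all_algebra.
From mathcomp Require Import all_classical all_reals all_analysis.
From mathcomp Require Import measurable_realfun zify.

Set Implicit Arguments.
Unset Strict Implicit.
Unset Printing Implicit Defensive.

Import Order.TTheory GRing.Theory Num.Theory.

Local Open Scope classical_set_scope.
Local Open Scope ring_scope.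

(** The argument is an exchange argument, and has no probability in it apart
    from two almost sure facts: the weights of the box are nonnegative, and two
    different sets of vertices of the box have different total weights.  For
    the second fact, two equal sums express the weight of some vertex [v] as a
    linear combination of the weights of other vertices, which is independent
    of it; as the law of the weight of [v] has no atoms, this has probability
    zero ([negligible_eq_independent_atomless], [lincomb_independent],
    [ae_distinct_sums]).

    Fix such an environment.  A family of disjoint paths with the prescribed
    endpoints is encoded by the abscissa [X i t] of its [i]-th path at time
    [t], each path being prolonged outside of the box by horizontal lines
    ([curve_system]).  Let [X] and [Y] be optimal families with [k] and [k + 1]
    curves.  Replacing [X i] by [max (X i) (Y i)] and [Y i] by
    [min (X i) (Y i)] for all [i < k] gives two families with the same endpoints
    ([swap_lower]), and at each time the multiset of occupied vertices is
    unchanged.  The sum of the two weights is therefore unchanged, so that by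
    optimality neither weight changes, and distinctness of sums forces
    [max (X i) (Y i) = X i].  Exchanging [X i] with [Y (i + 1)] gives
    [X i <= Y (i + 1)] in the same way ([swap_upper]).  These two inequalities
    are the interlacing ([interlace_distinct_sums]).

    It remains to see that an optimal family with the prescribed endpoints is
    also optimal among all collections of [k] disjoint paths in the box, whose
    endpoints are free.  The vertices of such a collection contain no
    [k + 1] vertices of which each lies strictly north-west of the next, because two
    vertices of one path are never in this position.  Conversely every set
    without such a chain is covered by [k] curves ([cover_by_system]): classify the
    vertices by the length of the longest chain that ends there, and
    let the [i]-th curve be the rightmost one which stays weakly to the left of all
    vertices of depth at least [i].  Nonnegativity of the weights then makes
    the covering family at least as heavy ([dominated_by_system]). *)

(** * Families of curves as functions of time *)

Definition vertex_at (x : nat -> int) (t : nat) : vertex := (x t, t%:Z - x t).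

Definition unit_steps (x : nat -> int) : Prop :=
  forall t, x t <= x t.+1 <= x t + 1.

(** The last two clauses prescribe the horizontal half-lines that end at
    [(1, k - i)] and that start at [(n, n - i)].  With them the curves exist at
    all times, so that families with different numbers of curves, whose paths
    have different starting times, can be compared at each time. *)
Definition curve_system (n k : nat) (X : nat -> nat -> int) : Prop :=
  [/\ forall i, (i < k)%N -> unit_steps (X i),
      forall i t, (i.+1 < k)%N -> X i t < X i.+1 t,
      forall i t, (i < k)%N -> (t <= (k - i).+1)%N -> X i t = t%:Z - (k%:Z - i%:Z)
    & forall i t, (i < k)%N -> (2 * n - i <= t)%N -> X i t = t%:Z - (n%:Z - i%:Z)].

Definition curve (n k : nat) (X : nat -> nat -> int) (i : nat) : seq vertex :=
  [seq vertex_at (X i) t | t <- iota (k - i).+1 (2 * n - k)].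

Definition curves (n k : nat) (X : nat -> nat -> int) : k.-tuple (seq vertex) :=
  [tuple curve n k X i | i < k].

Lemma unit_steps_le (x : nat -> int) (s t : nat) :
  unit_steps x -> (s <= t)%N -> x s <= x t <= x s + (t%:Z - s%:Z).
Proof.
move=> xs /subnK <-; elim: (t - s)%N => [|m IH]; first by rewrite add0n; lia.
by have := xs (m + s)%N; rewrite addSn; lia.
Qed.

Lemma system_lt (n k : nat) X (i j t : nat) : curve_system n k X ->
  (i < j)%N -> (j < k)%N -> X i t < X j t.
Proof.
move=> [_ lt _ _]; elim: j => // j IH; rewrite ltnS leq_eqVlt => /orP[/eqP->|ij] jk.
  exact: lt.
by apply: lt_trans (IH ij (ltnW jk)) (lt _ _ jk).
Qed.

Lemma system_inj (n k : nat) X (i j t : nat) : curve_system n k X ->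
  (i < k)%N -> (j < k)%N -> X i t = X j t -> i = j.
Proof.
move=> sX ik jk eX; case: (ltngtP i j) => // ij.
  by have := system_lt t sX ij jk; rewrite eX ltxx.
by have := system_lt t sX ij ik; rewrite eX ltxx.
Qed.

(** A curve enters the box exactly at its prescribed starting vertex and leaves
    it at its prescribed last vertex, since both coordinates are monotone. *)
Lemma vertex_at_in_box (n k : nat) X (i t : nat) : curve_system n k X ->
  (k <= n)%N -> (i < k)%N ->
  (vertex_at (X i) t \in box n) = (k - i < t <= 2 * n - i)%N.
Proof.
move=> [sl _ early late] kn ik; rewrite inE /=.
case: (leqP t (k - i)) => tk.
  by have := early i t ik (leqW tk); lia.
case: (leqP t (2 * n - i)) => tn /=; last first.
  by have := late i t ik (ltnW tn); lia.
have := early i _ ik (leqnn _); have := late i _ ik (leqnn _).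
have := unit_steps_le (sl i ik) tk; have := unit_steps_le (sl i ik) tn.
lia.
Qed.

Lemma mem_curve (n k : nat) X (i : nat) (v : vertex) : curve_system n k X ->
  (k <= n)%N -> (i < k)%N ->
  v \in curve n k X i <-> exists t, v = vertex_at (X i) t /\ (k - i < t <= 2 * n - i)%N.
Proof.
move=> sX kn ik; split.
  by case/mapP=> t; rewrite mem_iota => tw ->; exists t; split=> //; lia.
by case=> t [-> tw]; apply: map_f; rewrite mem_iota; lia.
Qed.

Lemma time_vertex_at x t : time (vertex_at x t) = t%:Z.
Proof. by rewrite /time /=; lia. Qed.

Lemma curves_disjoint (n k : nat) X : curve_system n k X -> (k <= n)%N ->
  disjoint_upright_paths n (curves n k X).
Proof.
move=> sX kn; have [sl lt early late] := sX; split=> i.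
- rewrite tnth_mktuple /upright_path; apply/andP; split.
    by have ik := ltn_ord i; rewrite -size_eq0 size_map size_iota; lia.
  rewrite sorted_map; apply: (@sub_sorted _ [rel s t | t == s.+1]).
    move=> s _ /eqP ->; rewrite /vertex_at /upright_step /= !xpair_eqE.
    by have := sl i (ltn_ord i) s; lia.
  elim: (2 * n - k)%N (k - i).+1 => // -[//|m] IH a.
  by rewrite /= eqxx /=; exact: (IH a.+1).
- move=> v; rewrite tnth_mktuple => /mapP[t]; rewrite mem_iota => tw ->.
  by have ik := ltn_ord i; rewrite (vertex_at_in_box _ sX) //; lia.
- move=> j ij v []; rewrite !tnth_mktuple => /mapP[s _ ->] /mapP[t _ e].
  have st : s = t by have := congr1 time e; rewrite !time_vertex_at; case.
  move: e => [e _]; rewrite st in e; move/eqP: ij; apply.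
  exact/val_inj/(system_inj sX _ _ e).
Qed.

Lemma curves_endpoints (n k : nat) X : curve_system n k X -> (k <= n)%N ->
  left_to_right_endpoints n (curves n k X).
Proof.
move=> [sl lt early late] kn i; have ik := ltn_ord i; rewrite tnth_mktuple /curve.
have -> : (2 * n - k = (2 * n - k).-1.+1)%N by lia.
split.
  by rewrite /= /vertex_at early //; congr pair; lia.
rewrite -[((2 * n - k).-1).+1]addn1 iotaD map_cat last_cat /= /vertex_at late //;
  last by lia.
by congr pair; lia.
Qed.

Lemma sum_flatten_tuple (R : realType) (w : vertex -> R) k (G : k.-tuple (seq vertex)) :
  collection_weight w G = \sum_(v <- flatten G) w v.
Proof.
by rewrite big_flatten big_tuple.
Qed.

(** * Every tuple with the prescribed endpoints is a family of curves *)

Lemma upright_step_time u v : upright_step u v ->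
  time v = time u + 1 /\ u.1 <= v.1 <= u.1 + 1.
Proof. by case: u v => [a b] [c d]; rewrite /upright_step /time /= !xpair_eqE; lia. Qed.

Lemma upright_nth_step p s : sorted upright_step p -> (s.+1 < size p)%N ->
  upright_step (nth (0, 0) p s) (nth (0, 0) p s.+1).
Proof. by move=> /(sortedP (0, 0)); apply. Qed.

Lemma upright_nth_time p s : sorted upright_step p -> (s < size p)%N ->
  time (nth (0, 0) p s) = time (head (0, 0) p) + s%:Z.
Proof.
move=> ps; elim: s => [|s IH] sp; first by rewrite nth0; lia.
by have [-> _] := upright_step_time (upright_nth_step ps sp); rewrite IH //; lia.
Qed.

(** The components are listed from left to right because they start in that
    order and cannot cross: two curves that move by at most one unit per
    time step would have to meet first, against disjointness. *)
Lemma curves_of_watermelon (n k : nat) (G : k.-tuple (seq vertex)) : (k <= n)%N ->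
  disjoint_upright_paths n G -> left_to_right_endpoints n G ->
  exists X, curve_system n k X /\ G = curves n k X.
Proof.
move=> kn [up _ disj] ends.
pose p i := nth [::] G i.
have pE (i : 'I_k) : p i = tnth G i by rewrite /p (tnth_nth [::]).
have P0 i : (i < k)%N -> [/\ sorted upright_step (p i), size (p i) = (2 * n - k)%N,
    head (0, 0) (p i) = (1, k%:Z - i%:Z) & last (0, 0) (p i) = (n%:Z, n%:Z - i%:Z)].
  move=> ik; have := up (Ordinal ik); have := ends (Ordinal ik); rewrite -pE /=.
  move=> [h l] /andP[pn ps]; split=> //; move: pn; rewrite -size_eq0 => sz.
  have sz' : ((size (p i)).-1 < size (p i))%N by rewrite ltn_predL lt0n.
  have := upright_nth_time ps sz'; rewrite nth_last l h /time /=; lia.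
have disj' i j s t : (i < j)%N -> (j < k)%N -> (s < size (p i))%N -> (t < size (p j))%N ->
    nth (0, 0) (p i) s <> nth (0, 0) (p j) t.
  move=> ij jk ss tt e; have ik := ltn_trans ij jk.
  apply: (disj (Ordinal ik) (Ordinal jk) _ (nth (0, 0) (p i) s)).
    by rewrite -val_eqE /=; lia.
  by rewrite -!pE /= {2}e !mem_nth.
pose X i (t : nat) : int := if (t <= k - i)%N then t%:Z - (k%:Z - i%:Z) else
  if (t <= 2 * n - i)%N then (nth (0, 0) (p i) (t - (k - i).+1)).1
  else t%:Z - (n%:Z - i%:Z).
have XE i t : (i < k)%N -> (k - i < t <= 2 * n - i)%N ->
    vertex_at (X i) t = nth (0, 0) (p i) (t - (k - i).+1).
  move=> ik tw; have [ps sp h _] := P0 i ik.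
  have := @upright_nth_time _ (t - (k - i).+1) ps.
  rewrite /vertex_at /X h /time /=; case: (leqP t (k - i)) => [|_]; first by lia.
  case: (leqP t (2 * n - i)) => [_|]; last by lia.
  case: (nth _ _ _) => a b /= tE; congr pair; lia.
have early i t : (i < k)%N -> (t <= (k - i).+1)%N -> X i t = t%:Z - (k%:Z - i%:Z).
  move=> ik; rewrite /X; case: (leqP t (k - i)) => // t1 t2.
  case: leqP => [t3|]; last by lia.
  have -> : (t - (k - i).+1 = 0)%N by lia.
  by have [_ _ h _] := P0 i ik; rewrite nth0 h /=; lia.
have late i t : (i < k)%N -> (2 * n - i <= t)%N -> X i t = t%:Z - (n%:Z - i%:Z).
  move=> ik ti; rewrite /X; case: leqP => [|_]; first by lia.
  case: (leqP t (2 * n - i)) => // t2; have [_ s _ h] := P0 i ik.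
  have -> : (t - (k - i).+1 = (size (p i)).-1)%N by lia.
  by rewrite nth_last h /=; lia.
have sl i : (i < k)%N -> unit_steps (X i).
  move=> ik t; case: (leqP t (k - i)) => t1.
    by rewrite !early //; lia.
  case: (leqP (2 * n - i) t) => t2; first by rewrite !late //; lia.
  have [ps sp h _] := P0 i ik.
  have := upright_step_time (@upright_nth_step _ (t - (k - i).+1) ps _).
  rewrite -subSn // -!XE //= ?sp; lia.
(* Outside of the common time window of the two paths both positions are
   prescribed. *)
have lt i t : (i.+1 < k)%N -> X i t < X i.+1 t.
  move=> ik; elim: t => [|t IH]; first by rewrite !early //; lia.
  case: (leqP t.+1 (k - i)) => t1; first by rewrite !early //; lia.
  case: (leqP (2 * n - i.+1) t) => t2; first by rewrite !late //; lia.
  have := sl i (ltnW ik) t; have := sl i.+1 ik t.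
  have [_ sp _ _] := P0 i (ltnW ik); have [_ sp' _ _] := P0 i.+1 ik.
  have := @disj' i i.+1 (t.+1 - (k - i).+1)%N (t.+1 - (k - i.+1).+1)%N (ltnSn _) ik.
  rewrite -!XE; [|lia..].
  rewrite sp sp' /vertex_at => ne h1 h2.
  suff : X i t.+1 <> X i.+1 t.+1 by lia.
  by move=> e; apply: ne; [lia|lia|rewrite e].
exists X; split; first by [].
apply: eq_from_tnth => i; rewrite tnth_mktuple -pE.
have ik := ltn_ord i; have [ps sp _ _] := P0 i ik.
apply: (@eq_from_nth _ (0, 0)); first by rewrite size_map size_iota.
move=> s sz; rewrite (nth_map 0%N) ?size_iota -?sp // nth_iota -?sp //.
rewrite XE //; last by move: sz; rewrite sp; lia.
by congr nth; lia.
Qed.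

(** * Weights and uniqueness *)

(** The extension by zero lets the weights of all curves be sums over one and the
    same range of times. *)
Definition in_box_weight (R : realType) (n : nat) (w : vertex -> R) (v : vertex) : R :=
  if v \in box n then w v else 0.

Lemma curves_weight (R : realType) (w : vertex -> R) (n k : nat) X :
  curve_system n k X -> (k <= n)%N ->
  collection_weight w (curves n k X) =
  \sum_(i < k) \sum_(0 <= t < (2 * n).+1) in_box_weight n w (vertex_at (X i) t).
Proof.
move=> sX kn; apply: eq_bigr => i _; rewrite tnth_mktuple /path_weight big_map.
rewrite /in_box_weight -big_mkcond /= -[RHS]big_filter.
apply: perm_big; apply: uniq_perm.
- exact: iota_uniq.
- by rewrite filter_uniq // iota_uniq.
move=> t; rewrite mem_filter (vertex_at_in_box _ sX) // mem_index_iota mem_iota.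
by have ik := ltn_ord i; lia.
Qed.

Definition distinct_sums (R : realType) (n : nat) (w : vertex -> R) : Prop :=
  forall s1 s2 : seq vertex, uniq s1 -> uniq s2 ->
    {subset s1 <= box n} -> {subset s2 <= box n} ->
    \sum_(v <- s1) w v = \sum_(v <- s2) w v -> s1 =i s2.

(** An increasing enumeration is determined by the set of its values. *)
Lemma increasing_eq (k : nat) (f g : nat -> int) :
  (forall i j, (i < j)%N -> (j < k)%N -> f i < f j) ->
  (forall i j, (i < j)%N -> (j < k)%N -> g i < g j) ->
  (forall i, (i < k)%N -> exists2 j, (j < k)%N & f i = g j) ->
  (forall i, (i < k)%N -> exists2 j, (j < k)%N & g i = f j) ->
  forall i, (i < k)%N -> f i = g i.
Proof.
move=> fi gi fg gf i ik.
have srt (h : nat -> int) : (forall i j, (i < j)%N -> (j < k)%N -> h i < h j) ->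
    sorted <%O [seq h i | i <- iota 0 k].
  move=> hi; rewrite sorted_map; apply/(sortedP 0%N) => j.
  by rewrite size_iota => jk; rewrite /= !nth_iota //; [apply: hi; lia|lia].
have E : [seq f i | i <- iota 0 k] = [seq g i | i <- iota 0 k].
  apply: (irr_sorted_eq lt_trans ltxx); [exact: srt|exact: srt|].
  move=> z; apply/mapP/mapP => -[j]; rewrite mem_iota /= add0n => jk ->.
    by have [l lk ->] := fg j jk; exists l; rewrite // mem_iota.
  by have [l lk ->] := gf j jk; exists l; rewrite // mem_iota.
have := congr1 (fun s => nth 0 s i) E.
by rewrite !(nth_map 0%N) ?size_iota // nth_iota.
Qed.

Lemma uniq_flatten_disjoint (T : eqType) (k : nat) (G : nat -> seq T) :
  (forall i, (i < k)%N -> uniq (G i)) ->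
  (forall i j v, (i < j)%N -> (j < k)%N -> v \in G i -> v \in G j -> False) ->
  uniq (flatten [seq G i | i <- iota 0 k]).
Proof.
elim: k => [//|k IH] u d; rewrite -addn1 iotaD map_cat flatten_cat cat_uniq /= cats0.
rewrite u // andbT IH /=; [|by move=> i ik; apply: u; lia|]; last first.
  by move=> i j v ij jk; apply: d; lia.
apply/hasPn => v vk; apply/flatten_mapP => -[i].
by rewrite mem_iota => ik vi; apply: (d i k v) => //; lia.
Qed.

Lemma disjoint_paths_uniq (n k : nat) (G : k.-tuple (seq vertex)) :
  disjoint_upright_paths n G -> uniq (flatten G) /\ {subset flatten G <= box n}.
Proof.
move=> [up inb disj]; split; last first.
  by move=> v /flattenP[p /tnthP[i ->]]; exact: inb.
have GE i (ik : (i < k)%N) : nth [::] G i = tnth G (Ordinal ik).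
  by rewrite (tnth_nth [::]).
rewrite -[tval G](mkseq_nth [::]) size_tuple; apply: uniq_flatten_disjoint.
- move=> i ik; have /andP[_ ps] := up (Ordinal ik); rewrite [X in uniq X](GE i ik).
  apply: (@map_uniq _ _ time); apply: (sorted_uniq (leT := <%O)).
  + exact: lt_trans.
  + exact: ltxx.
  + rewrite sorted_map; apply: sub_sorted ps => u v /upright_step_time[e _].
    by rewrite /= e; lia.
- move=> i j v ij jk vi vj; have ik := ltn_trans ij jk.
  apply: (disj (Ordinal ik) (Ordinal jk) _ v); first by rewrite -val_eqE /=; lia.
  by split; rewrite -GE.
Qed.

Lemma mem_flatten_curves (n k : nat) X (v : vertex) : curve_system n k X ->
  (k <= n)%N ->
  v \in flatten (curves n k X) <->
  exists i t, [/\ (i < k)%N, (k - i < t <= 2 * n - i)%N & v = vertex_at (X i) t].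
Proof.
move=> sX kn; split.
  move=> /flattenP[p /tnthP[i ->]]; rewrite tnth_mktuple.
  by move=> /(mem_curve v sX kn (ltn_ord i))[t [-> tw]]; exists i, t.
move=> [i [t [ik tw ->]]]; apply/flattenP; exists (curve n k X i).
  by apply/tnthP; exists (Ordinal ik); rewrite tnth_mktuple.
by apply/(mem_curve _ sX kn ik); exists t.
Qed.

(** Equal weights give equal sets of vertices, hence equal sets of
    positions at each time, hence equal curves as these are listed increasingly. *)
Lemma equal_weight_eq (R : realType) (w : vertex -> R) (n k : nat) X Y :
  (k <= n)%N -> distinct_sums n w -> curve_system n k X -> curve_system n k Y ->
  collection_weight w (curves n k X) = collection_weight w (curves n k Y) ->
  forall i t, (i < k)%N -> X i t = Y i t.
Proof.
move=> kn dw sX sY eW i t ik.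
have [uX bX] := disjoint_paths_uniq (curves_disjoint sX kn).
have [uY bY] := disjoint_paths_uniq (curves_disjoint sY kn).
rewrite !sum_flatten_tuple in eW.
have E := dw _ _ uX uY bX bY eW.
(* Out of the time window of the curve the position is the prescribed one, which
   is the same in both families. *)
have sub Z Z' j : curve_system n k Z -> curve_system n k Z' ->
    flatten (curves n k Z) =i flatten (curves n k Z') ->
    (j < k)%N -> exists2 l, (l < k)%N & Z j t = Z' l t.
  move=> sZ sZ' eZ jk; have [_ _ ea la] := sZ; have [_ _ ea' la'] := sZ'.
  case: (leqP t (k - j)) => t1; first by exists j; rewrite // ea ?ea' //; lia.
  case: (leqP (2 * n - j) t) => t2; first by exists j; rewrite // la ?la' //; lia.
  have : vertex_at (Z j) t \in flatten (curves n k Z').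
    by rewrite -eZ; apply/(mem_flatten_curves _ sZ kn); exists j, t; split=> //; lia.
  move=> /(mem_flatten_curves _ sZ' kn)[l [s [lk _ e]]].
  have ts : t = s by have := congr1 time e; rewrite !time_vertex_at; case.
  by exists l => //; move: e; rewrite -ts; case.
apply: (@increasing_eq k (X^~ t) (Y^~ t)) => // [a b||a ak|a ak].
- exact: (system_lt t sX).
- by move=> a b; apply: (system_lt t sY).
- exact: sub.
- by apply: sub => // v; rewrite E.
Qed.

(** * Exchanging curves between two families *)

(** The half-lines are preserved: at late times [X i] and [Y i] coincide, and at
    early times [Y i] runs one row above [X i], that is, to its left. *)
Lemma swap_lower (n k : nat) X Y : (k < n)%N ->
  curve_system n k X -> curve_system n k.+1 Y ->
  curve_system n k (fun i t => Num.max (X i t) (Y i t)) /\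
  curve_system n k.+1 (fun i t => if (i < k)%N then Num.min (X i t) (Y i t) else Y i t).
Proof.
move=> kn [sX lX eX laX] [sY lY eY laY]; split; split.
- by move=> i ik t; have := sX i ik t; have := sY i (leqW ik) t; lia.
- by move=> i t ik; have := lX i t ik; have := lY i t (leqW ik); lia.
- move=> i t ik ti; rewrite eX // eY; lia.
- by move=> i t ik ti; rewrite laX // laY //; lia.
- move=> i ik t; have := sY i ik t; case: ifP => // ik'.
  by have := sX i ik' t; lia.
- move=> i t ik; have := lY i t ik; rewrite ltnS in ik; rewrite ik.
  by case: ifP => // ik'; [have := lX i t ik'|]; lia.
- move=> i t ik ti; rewrite eY //; case: ifP => // ik'.
  case: (leqP t (k - i).+1) => t1; first by rewrite eX //; lia.
  (* This is the starting time of [Y i], one unit after that of [X i], so that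
     [X i] may share its vertex but cannot be to its left. *)
  have -> : t = (k - i).+2 by lia.
  by have := eX i (k - i).+1 ik' (leqnn _); have := sX i ik' (k - i).+1; lia.
- move=> i t ik ti; rewrite laY //; case: ifP => // ik'.
  by rewrite laX //; lia.
Qed.

(** Here [X i] and [Y (i + 1)] coincide at early times, and at late times
    [Y (i + 1)] runs one row below [X i], that is, to its right. *)
Lemma swap_upper (n k : nat) X Y : (k < n)%N ->
  curve_system n k X -> curve_system n k.+1 Y ->
  curve_system n k (fun i t => Num.min (X i t) (Y i.+1 t)) /\
  curve_system n k.+1 (fun i t => if i is j.+1 then Num.max (X j t) (Y i t) else Y i t).
Proof.
move=> kn [sX lX eX laX] [sY lY eY laY]; split; split.
- by move=> i ik t; have := sX i ik t; have := sY i.+1 ik t; lia.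
- by move=> i t ik; have := lX i t ik; have := lY i.+1 t ik; lia.
- by move=> i t ik ti; rewrite eX // eY //; lia.
- by move=> i t ik ti; rewrite laX // laY //; lia.
- move=> [|i] ik t; have := sY _ ik t; first by [].
  by have := sX i ik t; lia.
- move=> [|i] t ik; have := lY _ t ik; first by lia.
  by have := lX i t ik; lia.
- by move=> [|i] t ik ti; rewrite eY //; rewrite eX //; lia.
- move=> [|i] t ik ti; rewrite laY //.
  case: (leqP (2 * n - i) t) => t1; first by rewrite laX //; lia.
  have := laX i (2 * n - i)%N ik (leqnn _); have := sX i ik t.
  have -> : (2 * n - i = t.+1)%N by lia.
  lia.
Qed.

Lemma swap_weight (R : realType) (w : vertex -> R) (n m : nat) (x y : nat -> int) :
  \sum_(0 <= t < m) in_box_weight n w (vertex_at (fun t => Num.max (x t) (y t)) t) +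
  \sum_(0 <= t < m) in_box_weight n w (vertex_at (fun t => Num.min (x t) (y t)) t) =
  \sum_(0 <= t < m) in_box_weight n w (vertex_at x t) +
  \sum_(0 <= t < m) in_box_weight n w (vertex_at y t).
Proof.
rewrite -!big_split; apply: eq_bigr => t _; rewrite /= /vertex_at.
by case: (leP (x t) (y t)) => // _; rewrite addrC.
Qed.

(** * Covering a set of small width by curves *)

Definition northwest : rel vertex := [rel u v | (u.1 < v.1) && (v.2 < u.2)].

(** Some chain of [i + 1] elements of [U], each strictly north-west of the next,
    ends at [v]. *)
Fixpoint depth_ge (U : seq vertex) (i : nat) (v : vertex) : bool :=
  if i is j.+1 then (v \in U) && has (fun u => depth_ge U j u && northwest u v) U
  else v \in U.

Lemma depth_geW U i v : depth_ge U i.+1 v -> depth_ge U i v.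
Proof.
elim: i v => [|i IH] v; first by case/andP.
move=> /= /andP[-> /hasP[u uU /andP[du uv]]] /=; apply/hasP; exists u => //.
by rewrite uv andbT; apply: IH.
Qed.

Lemma depth_ge_mem U i v : depth_ge U i v -> v \in U.
Proof. by case: i => [//|i] /andP[]. Qed.

Lemma depth_ge_chain U i v : depth_ge U i v ->
  exists s, [/\ sorted northwest s, {subset s <= U} & size s = i.+1].
Proof.
suff H : depth_ge U i v -> exists s, [/\ path (fun a b => northwest b a) v s,
    {subset v :: s <= U} & size s = i].
  move=> /H[s [ps sU ss]]; exists (rev (v :: s)); split.
  - by rewrite rev_sorted.
  - by move=> u; rewrite mem_rev; exact: sU.
  - by rewrite size_rev /= ss.
elim: i v => [|i IH] v /=.
  by move=> vU; exists [::]; split=> // u; rewrite inE => /eqP->.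
move=> /andP[vU /hasP[u uU /andP[/IH[s [ps sU ss]] uv]]].
exists (u :: s); split; [by rewrite /= uv|move=> z|by rewrite /= ss].
by rewrite inE => /orP[/eqP->//|]; apply: sU.
Qed.

Lemma depth_ge_coord n U i v : {subset U <= box n} -> depth_ge U i v ->
  i%:Z + 1 <= v.1 /\ v.2 <= n%:Z - i%:Z.
Proof.
move=> Ub; elim: i v => [|i IH] v /=; first by move=> /Ub; rewrite inE /=; lia.
by move=> /andP[_ /hasP[u _ /andP[/IH]]]; rewrite /northwest /=; lia.
Qed.

(** Along a chain the abscissae increase and the ordinates decrease strictly
    within [1..n].  Hence a chain through [e] has fewer than [e.1] elements
    before it and fewer than [e.2] after it, and symmetrically from the other
    corner of the box. *)
Lemma chain_size_le n (s : seq vertex) (e : vertex) :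
  sorted northwest s -> {subset s <= box n} -> e \in s ->
  (size s)%:Z <= time e - 1 /\ (size s)%:Z <= 2 * n%:Z + 1 - time e.
Proof.
move=> ss sb es; rewrite /time; pose o : vertex := (0, 0).
have inb i : (i < size s)%N -> nth o s i \in box n by move=> /(mem_nth o)/sb.
have st i : (i.+1 < size s)%N -> northwest (nth o s i) (nth o s i.+1).
  by move=> ?; apply: (sortedP o ss).
have up i : (i < size s)%N ->
    i%:Z + 1 <= (nth o s i).1 /\ (nth o s i).2 <= n%:Z - i%:Z.
  elim: i => [|i IH] si; first by have := inb _ si; rewrite inE /=; lia.
  by have := IH (ltnW si); have := st _ si; rewrite /northwest /=; lia.
have dn j i : (i + j.+1 = size s)%N ->
    (nth o s i).1 <= n%:Z - j%:Z /\ j%:Z + 1 <= (nth o s i).2.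
  elim: j i => [|j IH] i si.
    by have := inb i; rewrite -si addn1 ltnSn inE /= => /(_ isT); lia.
  have lt1 : (i.+1 < size s)%N by lia.
  have := IH i.+1; rewrite -si addSnnS => /(_ erefl).
  by have := st i lt1; rewrite /northwest /=; lia.
move/(nthP o): es => [i is' es].
have {is'}si : (i < size s)%N := is'.
have {}es : e = nth o s i by rewrite -es.
have ij : (i + (size s - i.+1).+1 = size s)%N by lia.
by rewrite es; have := up _ si; have := dn _ _ ij; lia.
Qed.

Lemma foldr_minP (a : int) (s : seq int) :
  [/\ foldr Num.min a s <= a, forall z, z \in s -> foldr Num.min a s <= z &
      foldr Num.min a s = a \/ foldr Num.min a s \in s].
Proof.
elim: s => [|b s [IH1 IH2 IH3]] /=; first by split=> //; left.
split; first by rewrite ge_min IH1 orbT.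
  by move=> z; rewrite inE ge_min => /orP[/eqP->|/IH2->]; rewrite ?lexx ?orbT.
case: (leP b (foldr Num.min a s)) => _; first by right; rewrite mem_head.
by case: IH3 => [->|m]; [left|right; rewrite inE m orbT].
Qed.

(** At time [t] a curve which stays weakly to the left of [u] has abscissa at
    most [max u.1 (t - u.2)], so that the minimum of these bounds over the
    vertices of depth at least [i] is the rightmost admissible [i]-th curve.  It
    passes through every vertex [u] of depth exactly [i], for a vertex imposing
    a smaller bound at [u] would lie north-west of [u] and increase its depth.
    Consecutive curves are disjoint: a vertex of depth [i + 1] has a vertex of
    depth [i] north-west of it, whose bound is smaller by at least one. *)
Lemma cover_by_system (n k : nat) (U : seq vertex) : (k <= n)%N ->
  {subset U <= box n} ->
  (forall s, sorted northwest s -> {subset s <= U} -> (size s <= k)%N) ->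
  exists X, curve_system n k X /\ {subset U <= flatten (curves n k X)}.
Proof.
move=> kn Ub width.
(* The antidiagonals of length [k] at the two corners of the box are added to
   [U] so that the curves end up in the prescribed rows.  Chains through them
   have at most [k] elements, so the width does not increase. *)
pose E m : vertex := (m%:Z + 1, k%:Z - m%:Z).
pose L m : vertex := (n%:Z - k%:Z + 1 + m%:Z, n%:Z - m%:Z).
pose V := U ++ [seq E m | m <- iota 0 k] ++ [seq L m | m <- iota 0 k].
have VP v : v \in V -> [\/ v \in U, exists2 m, (m < k)%N & v = E m |
    exists2 m, (m < k)%N & v = L m].
  rewrite !mem_cat => /or3P[->||]; first by constructor 1.
    by move=> /mapP[m]; rewrite mem_iota => mk ->; constructor 2; exists m.
  by move=> /mapP[m]; rewrite mem_iota => mk ->; constructor 3; exists m.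
have EV m : (m < k)%N -> E m \in V.
  by move=> mk; rewrite !mem_cat map_f ?orbT // mem_iota.
have LV m : (m < k)%N -> L m \in V.
  by move=> mk; rewrite !mem_cat (map_f L) ?orbT // mem_iota.
have Vb : {subset V <= box n}.
  by move=> v /VP[/Ub //|[m mk ->]|[m mk ->]]; rewrite inE /=; lia.
have Vwidth s : sorted northwest s -> {subset s <= V} -> (size s <= k)%N.
  move=> ss sV; case: (boolP (all (fun v => v \in U) s)) => [/allP|/allPn[v vs vU]].
    exact: width.
  have := chain_size_le ss (fun u us => Vb u (sV u us)) vs; rewrite /time => h.
  move: h.
  by case: (VP v (sV v vs)) => [|[m mk ->]|[m mk ->]]; rewrite ?(negPf vU) //=; lia.
have dE m : (m < k)%N -> depth_ge V m (E m).
  elim: m => [|m IH] mk; first exact: EV.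
  rewrite /= EV //=; apply/hasP; exists (E m); first by apply: EV; lia.
  by rewrite IH ?(ltnW mk) //= /northwest /=; lia.
have dL m : (m < k)%N -> depth_ge V m (L m).
  elim: m => [|m IH] mk; first exact: LV.
  rewrite /= LV //=; apply/hasP; exists (L m); first by apply: LV; lia.
  by rewrite IH ?(ltnW mk) //= /northwest /=; lia.
pose f (u : vertex) (t : nat) : int := Num.max u.1 (t%:Z - u.2).
(* The default value of the minimum keeps the curve in the row of [E i] until it
   reaches [E i]. *)
pose X (i t : nat) : int := foldr Num.min (t%:Z - (k%:Z - i%:Z))
  [seq f u t | u <- V & depth_ge V i u].
have XP i t := foldr_minP (t%:Z - (k%:Z - i%:Z)) [seq f u t | u <- V & depth_ge V i u].
have X1 i t : X i t <= t%:Z - (k%:Z - i%:Z) by have [] := XP i t.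
have X2 i t u : depth_ge V i u -> X i t <= f u t.
  move=> du; have [_ + _] := XP i t.
  by apply; apply: (map_f (fun u => f u t)); rewrite mem_filter du (depth_ge_mem du).
have X3 i t : X i t = t%:Z - (k%:Z - i%:Z) \/ exists2 u, depth_ge V i u & X i t = f u t.
  have [_ _] := XP i t.
  case=> [|/mapP[u]]; first by left.
  by rewrite mem_filter => /andP[du _] e; right; exists u.
have tri i t : (i < k)%N -> (t <= k.+1)%N -> X i t = t%:Z - (k%:Z - i%:Z).
  move=> ik ti; have [//|[u du e]] := X3 i t.
  by have := depth_ge_coord Vb du; have := X1 i t; rewrite e /f; lia.
have sX : curve_system n k X.
  split.
  - move=> i ik t; apply/andP; split.
      have [->|[u du ->]] := X3 i t.+1.
        by have := X1 i t; lia.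
      by have := X2 i t u du; rewrite /f; lia.
    have [->|[u du ->]] := X3 i t.
      by have := X1 i t.+1; lia.
    by have := X2 i t.+1 u du; rewrite /f; lia.
  - move=> i t ik; have [->|[u du ->]] := X3 i.+1 t.
      by have := X1 i t; lia.
    move: du => /= /andP[_ /hasP[v _ /andP[dv]]]; rewrite /northwest /= => vu.
    by have := X2 i t v dv; rewrite /f; lia.
  - by move=> i t ik ti; apply: tri => //; lia.
  - move=> i t ik ti; have := X2 i t _ (dL i ik); rewrite /f /= => h.
    have [e|[u du e]] := X3 i t; first by lia.
    by have := depth_ge_coord Vb du; rewrite e /f in h *; lia.
exists X; split=> //.
suff cov (u : vertex) : u \in U -> u \in flatten (curves n k X) by move=> u /cov.
move=> uU.
have uV : u \in V by rewrite mem_cat uU.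
have ub := Ub u uU.
have nk : ~~ depth_ge V k u.
  by apply/negP => /depth_ge_chain[s [ss sV sz]]; have := Vwidth s ss sV; rewrite sz ltnn.
(* The exact depth of [u], which is less than [k]. *)
have [i [ik di ndi]] : exists i, [/\ (i < k)%N, depth_ge V i u & ~~ depth_ge V i.+1 u].
  elim: (k) nk => [|m IH] nd; first by rewrite /= uV in nd.
  case: (boolP (depth_ge V m u)) => [dm|/IH[i [im di ndi]]]; first by exists m.
  by exists i; split=> //; exact: leqW.
have low v : depth_ge V i v -> ~~ northwest v u.
  move=> dv; apply: contra ndi => vu; rewrite /= uV /=; apply/hasP; exists v.
    exact: depth_ge_mem dv.
  by rewrite dv vu.
move: ub; rewrite inE /= => ub.
pose t := `|time u|%N.
have ut : t%:Z = u.1 + u.2 by rewrite /t /time; lia.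
have [j [jk e]] : exists j, (j < k)%N /\ X j t = u.1.
  (* Up to time [k + 1] the curves fill whole antidiagonals of the box, so that
     [u] is on the curve that runs in its row; later it is on the curve whose
     index is its depth. *)
  case: (leqP t k.+1) => tk.
    by exists (k - `|u.2|)%N; split; [|rewrite tri //]; lia.
  exists i; split=> //; apply/eqP; rewrite eq_le; apply/andP; split.
    by have := X2 i t u di; rewrite /f ut; lia.
  have [->|[v dv ->]] := X3 i t; rewrite /f ut.
    by have := low _ (dE i ik); rewrite /northwest /=; lia.
  by have := low _ dv; rewrite /northwest /=; lia.
apply/(mem_flatten_curves _ sX kn); exists j, t.
have uE : u = vertex_at (X j) t.
  by rewrite /vertex_at e ut; case: (u) => a b /=; congr pair; lia.
by split=> //; rewrite -(vertex_at_in_box _ sX) // -uE inE /=.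
Qed.

(** * Optimal families of curves *)

Lemma upright_path_northwest (p : seq vertex) (u v : vertex) : sorted upright_step p ->
  u \in p -> v \in p -> northwest u v = false.
Proof.
move=> ps up vp; pose le2 := [rel a b : vertex | (a.1 <= b.1) && (a.2 <= b.2)].
have tr : transitive le2.
  by move=> a b c /= /andP[h1 h2] /andP[h3 h4]; rewrite (le_trans h1 h3) (le_trans h2 h4).
have rf : reflexive le2 by move=> a /=; rewrite !lexx.
have ps2 : sorted le2 p.
  apply: sub_sorted ps => -[a b] [c d]; rewrite /upright_step /= !xpair_eqE; lia.
have H a b : a \in p -> b \in p -> (index a p <= index b p)%N -> le2 a b.
  move=> ap bp ab; have := sorted_leq_nth tr rf (0, 0) ps2 (index a p) (index b p).
  by rewrite !nth_index //; apply; rewrite // inE index_mem.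
apply/negP => /andP[h1 h2].
case/orP: (leq_total (index u p) (index v p)) => /H.
  by move=> /(_ up vp)/andP[_]; rewrite leNgt h2.
by move=> /(_ vp up)/andP[]; rewrite leNgt h1.
Qed.

(** Pigeonhole: the elements of a chain lie on different paths. *)
Lemma disjoint_paths_width (n k : nat) (G : k.-tuple (seq vertex)) (s : seq vertex) :
  disjoint_upright_paths n G -> sorted northwest s -> {subset s <= flatten G} ->
  (size s <= k)%N.
Proof.
move=> [up _ _] ss sG.
pose c v := find (fun p : seq vertex => v \in p) G.
have cP v : v \in s -> (c v < k)%N /\ v \in nth [::] G (c v).
  move=> /sG /flattenP[p pG vp].
  have h : has (fun p : seq vertex => v \in p) G by apply/hasP; exists p.
  by split; [rewrite /c -[X in (_ < X)%N](size_tuple G) -has_find|exact: (nth_find [::] h)].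
have tr : transitive northwest.
  by move=> a b d /andP[h1 h2] /andP[h3 h4]; rewrite /northwest /= (lt_trans h1) // (lt_trans h4).
have ltneq u v : northwest u v -> u \in s -> v \in s -> c u != c v.
  move=> uv us vs; apply/eqP => e; have [ck uc] := cP u us; have [_ vc] := cP v vs.
  have /andP[_ ps] := up (Ordinal ck).
  move: uc vc; rewrite -e => uc vc; move: ps; rewrite (tnth_nth [::]) /= => ps.
  by rewrite (upright_path_northwest ps uc vc) in uv.
have us : uniq (map c s).
  have : pairwise northwest s by rewrite -sorted_pairwise.
  elim: (s) ltneq => [//|a r IH] ne /= /andP[/allP ar pr].
  rewrite IH ?andbT //; last by move=> u v uv ur vr; apply: ne uv _ _; rewrite inE ?ur ?vr orbT.
  apply/mapP => -[b br e]; have := ne a b (ar b br); rewrite !inE eqxx br orbT => /(_ isT isT).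
  by rewrite e eqxx.
have /(uniq_leq_size us) : {subset map c s <= iota 0 k}.
  by move=> x /mapP[v /cP[ck _] ->]; rewrite mem_iota.
by rewrite size_map size_iota.
Qed.

Lemma dominated_by_system (R : realType) (w : vertex -> R) (n k : nat)
    (G : k.-tuple (seq vertex)) :
  (k <= n)%N -> (forall v, v \in box n -> 0 <= w v) -> disjoint_upright_paths n G ->
  exists X, curve_system n k X /\ collection_weight w G <= collection_weight w (curves n k X).
Proof.
move=> kn w0 dG; have [uG bG] := disjoint_paths_uniq dG.
have [X [sX cov]] := cover_by_system kn bG (fun s => @disjoint_paths_width n k G s dG).
exists X; split=> //; rewrite !sum_flatten_tuple.
have [uX bX] := disjoint_paths_uniq (curves_disjoint sX kn).
have -> : \sum_(v <- flatten G) w v =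
    \sum_(v <- flatten (curves n k X) | v \in flatten G) w v.
  rewrite -[RHS]big_filter; apply: perm_big; apply: uniq_perm; rewrite ?filter_uniq //.
  by move=> v; rewrite mem_filter andb_idr //; exact: cov.
rewrite [leRHS](bigID [in flatten G]) lerDl big_seq_cond sumr_ge0 //.
by move=> v /andP[/bX/w0].
Qed.

(** Only the finitely many positions inside of the box matter for the weight, so
    the maximum is taken over a finite type of codes. *)
Lemma exists_optimal_system (R : realType) (w : vertex -> R) (n k : nat) : (k <= n)%N ->
  exists X, curve_system n k X /\
    forall Y, curve_system n k Y ->
      collection_weight w (curves n k Y) <= collection_weight w (curves n k X).
Proof.
move=> kn.
pose F (c : {ffun 'I_k * 'I_(2 * n - k) -> 'I_n.+1}) : R :=
  \sum_(i < k) \sum_(s < 2 * n - k)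
    w ((c (i, s))%:Z, ((k - i).+1 + s)%N%:Z - (c (i, s))%:Z).
pose code (X : nat -> nat -> int) : {ffun 'I_k * 'I_(2 * n - k) -> 'I_n.+1} :=
  [ffun a : 'I_k * 'I_(2 * n - k) => inord `|X a.1 ((k - a.1).+1 + a.2)%N|%N].
have codeE X : curve_system n k X -> collection_weight w (curves n k X) = F (code X).
  move=> sX; apply: eq_bigr => i _; have ik := ltn_ord i.
  rewrite tnth_mktuple /path_weight big_map -[(k - i).+1]addn0 iotaDl big_map.
  rewrite -[X in iota _ X]subn0 -/(index_iota 0 (2 * n - k)) big_mkord.
  apply: eq_bigr => s _; have sn := ltn_ord s.
  have : vertex_at (X i) ((k - i).+1 + s) \in box n.
    by rewrite (vertex_at_in_box _ sX) //; lia.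
  rewrite inE /vertex_at ffunE /= addn0 => b.
  rewrite inordK; last by lia.
  by congr w; congr pair; lia.
have [X0 [sX0 _]] : exists X0, curve_system n k X0 /\
    {subset [::] <= flatten (curves n k X0)}.
  apply: cover_by_system => // -[//|a s] _ /(_ a).
  by rewrite mem_head => /(_ isT).
pose P c := `[< exists X, curve_system n k X /\ F (code X) = F c >].
have P0 : P (code X0) by apply/asboolP; exists X0.
case: (@Order.TotalTheory.arg_maxP _ R _ (code X0) P F P0) => c /asboolP[X [sX e]] mx.
exists X; split=> // Y sY; rewrite !codeE // e.
by apply: mx; apply/asboolP; exists Y.
Qed.

(** The set from which the watermelon is selected is inhabited, by an optimal
    family of curves; whichever element is selected is then such a family. *)
Lemma geodesic_watermelon_system (R : realType) (w : vertex -> R) (n k : nat) :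
  (k <= n)%N -> (forall v, v \in box n -> 0 <= w v) ->
  exists X, [/\ curve_system n k X, geodesic_watermelon n w k = curves n k X &
    forall Y, curve_system n k Y ->
      collection_weight w (curves n k Y) <= collection_weight w (curves n k X)].
Proof.
move=> kn w0; have [X [sX mX]] := exists_optimal_system w kn.
have ex : exists G : k.-tuple (seq vertex),
    is_geodesic_watermelon n w G /\ left_to_right_endpoints n G.
  exists (curves n k X); split; last exact: curves_endpoints.
  split; first exact: curves_disjoint.
  by move=> H /(dominated_by_system kn w0)[Y [sY le]]; exact: le_trans (mX Y sY).
have [[dG mG] eG] : is_geodesic_watermelon n w (geodesic_watermelon n w k) /\
    left_to_right_endpoints n (geodesic_watermelon n w k).
  by rewrite /geodesic_watermelon; case: xgetP => [G _ //|/(_ _)] no; case: ex => G /no.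
have [Z [sZ eZ]] := curves_of_watermelon kn dG eG.
exists Z; split=> // Y sY; rewrite -eZ; apply: mG; exact: curves_disjoint.
Qed.

(** * Interlacing *)

Lemma time_range_curve (n k : nat) X i (t : int) : curve_system n k X ->
  (k <= n)%N -> (i < k)%N -> t \in time_range (curve n k X i) ->
  exists s : nat, t = s%:Z /\ position (curve n k X i) t = X i s - (s%:Z - X i s).
Proof.
move=> sX kn ik tr; have := tr; rewrite /position => /mapP[u _ _].
have := tr; rewrite -index_mem size_map => lt.
have := mem_nth (0, 0) lt; rewrite (mem_curve _ sX) // => -[s [e _]].
have := nth_index 0 tr; rewrite (nth_map (0, 0)) // e time_vertex_at => <-.
by exists s.
Qed.

Lemma path_preceq_curves (n k l : nat) X Y (i j : nat) :
  curve_system n k X -> curve_system n l Y -> (k <= n)%N -> (l <= n)%N ->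
  (i < k)%N -> (j < l)%N ->
  (exists t, (k - i < t <= 2 * n - i)%N /\ (l - j < t <= 2 * n - j)%N) ->
  (forall t, X i t <= Y j t) ->
  path_preceq (curve n k X i) (curve n l Y j).
Proof.
move=> sX sY kn ln ik jl [t [t1 t2]] le; split.
  exists t%:Z; split; apply/mapP.
    exists (vertex_at (X i) t); last by rewrite time_vertex_at.
    by apply/(mem_curve _ sX kn ik); exists t.
  exists (vertex_at (Y j) t); last by rewrite time_vertex_at.
  by apply/(mem_curve _ sY ln jl); exists t.
move=> s /(time_range_curve sX kn ik)[a [-> ->]] /(time_range_curve sY ln jl)[b [[<-] ->]].
by have := le a; lia.
Qed.


Lemma interlace_distinct_sums (R : realType) (w : vertex -> R) (n k : nat) :
  (k < n)%N -> (forall v, v \in box n -> 0 <= w v) -> distinct_sums n w ->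
  interlace (geodesic_watermelon n w k) (geodesic_watermelon n w k.+1).
Proof.
move=> kn w0 dw; have kn' := ltnW kn.
have [X [sX -> mX]] := geodesic_watermelon_system kn' w0.
have [Y [sY -> mY]] := geodesic_watermelon_system kn w0.
(* If the total weight of both families is kept, then each of them stays
   optimal, and the first one is unchanged by uniqueness. *)
have key X' Y' : curve_system n k X' -> curve_system n k.+1 Y' ->
    collection_weight w (curves n k X') + collection_weight w (curves n k.+1 Y') =
    collection_weight w (curves n k X) + collection_weight w (curves n k.+1 Y) ->
    forall i t, (i < k)%N -> X' i t = X i t.
  move=> sX' sY' e; apply: (equal_weight_eq kn' dw sX' sX); apply/eqP.
  rewrite eq_le mX //=; have := mY _ sY'.
  by rewrite -(lerD2l (collection_weight w (curves n k X))) -e lerD2r.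
have lower i t : (i < k)%N -> Y i t <= X i t.
  move=> ik; have [s1 s2] := swap_lower kn sX sY.
  rewrite -(key _ _ s1 s2 _ i t ik) ?le_max ?lexx ?orbT //.
  rewrite !curves_weight // !(big_ord_recr k) /= ltnn !addrA; congr (_ + _).
  rewrite -!big_split; apply: eq_bigr => j _; rewrite /= ltn_ord.
  exact: swap_weight.
have upper i t : (i < k)%N -> X i t <= Y i.+1 t.
  move=> ik; have [s1 s2] := swap_upper kn sX sY.
  rewrite -(key _ _ s1 s2 _ i t ik) ?ge_min ?lexx ?orbT //.
  rewrite !curves_weight // !(big_ord_recl k) /= [LHS]addrCA [RHS]addrCA; congr (_ + _).
  rewrite -!big_split; apply: eq_bigr => j _; rewrite /= addrC.
  exact: swap_weight.
move=> i; rewrite !tnth_mktuple /=; have ik := ltn_ord i; split.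
  apply: path_preceq_curves => //; [by lia|exists (k - i).+2; lia|].
  by move=> t; exact: lower.
apply: path_preceq_curves => //; [exists (k - i).+1; rewrite /bump /=; lia|].
by move=> t; rewrite /bump /= add1n; exact: upper.
Qed.

(** * Sums of independent variables without atoms *)

Definition lincomb d (T : measurableType d) (R : realType) (I : Type)
    (X : I -> {mfun T >-> R}) (c : I -> R) (s : seq I) (x : T) : R :=
  \sum_(u <- s) c u * X u x.

Lemma measurable_lincomb d (T : measurableType d) (R : realType) (I : Type)
    (X : I -> {mfun T >-> R}) (c : I -> R) (s : seq I) :
  measurable_fun setT (lincomb X c s).
Proof.
by apply: measurable_sum => u; apply: measurable_funM.
Qed.

HB.instance Definition _ d (T : measurableType d) (R : realType) (I : Type)
    (X : I -> {mfun T >-> R}) (c : I -> R) (s : seq I) :=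
  isMeasurableFun.Build _ _ _ _ (lincomb X c s) (measurable_lincomb X c s).

(** Both sides are finite measures in [Z], and rectangles form a generating
    class stable under intersection. *)
Lemma independent_pair_event (d : measure_display) (T : measurableType d) (R : realType)
    (P : probability T R) (E : set T) (f : T -> R * R) :
  measurable E -> measurable_fun setT f ->
  (forall A B : set R, measurable A -> measurable B ->
    P (E `&` f @^-1` (A `*` B)) = (P E * P (f @^-1` (A `*` B)))%E) ->
  forall Z, measurable Z -> P (E `&` f @^-1` Z) = (P E * P (f @^-1` Z))%E.
Proof.
move=> mE mf H Z mZ.
have PE : P E \is a fin_num by exact: fin_num_measure.
have r0 : 0 <= fine (P E) by exact: fine_ge0.
pose m1 : measure _ R := pushforward (mrestr P mE) f.
pose m2 : measure _ R := mscale (NngNum r0) (pushforward P f).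
have m1E A : m1 mf A = P (E `&` f @^-1` A) by rewrite /m1 /= /pushforward /mrestr setIC.
have m2E A : m2 mf A = (P E * P (f @^-1` A))%E by rewrite /m2 /= /mscale /= fineK.
rewrite -m1E -m2E.
pose C : set (set (R * R)) :=
  [set A `*` B | A in measurable & B in measurable].
apply: (measure_unique C (fun=> setT)) => //.
- by rewrite measurable_prod_measurableType.
- move=> _ _ [A mA [B mB <-]] [A' mA' [B' mB' <-]]; rewrite -setXI.
  by exists (A `&` A'); [exact: measurableI|exists (B `&` B'); [exact: measurableI|]].
- by move=> _; exists setT => //; exists setT => //; rewrite setXTT.
- by rewrite bigcup_const.
- by move=> _ [A mA [B mB <-]]; rewrite m1E m2E H.
- move=> _; rewrite m1E preimage_setT setIT.
  exact: le_lt_trans (probability_le1 _ _) (ltry _).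
Qed.

(** The joint law is the product law, and by Fubini the diagonal is null because each
    of its sections is a single point. *)
Lemma negligible_eq_independent_atomless (d : measure_display) (T : measurableType d) (R : realType)
    (P : probability T R) (X Y : {RV P >-> R}) :
  (forall a, P (X @^-1` [set a]) = 0%E) ->
  (forall A B : set R, measurable A -> measurable B ->
    P (X @^-1` A `&` Y @^-1` B) = (P (X @^-1` A) * P (Y @^-1` B))%E) ->
  P.-negligible [set x | X x = Y x].
Proof.
move=> X0 XY.
pose f x := (Y x, X x).
have mf : measurable_fun setT f.
  by apply/measurable_fun_pairP; split; exact: measurable_funPT.
pose m : measure _ R := pushforward P f.
have prodE : forall Z, measurable Z -> (distribution P Y \x distribution P X)%E Z = m mf Z.
  apply: product_measure_unique => A B mA mB.
  by rewrite /m /= /pushforward muleC -XY // setIC.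
pose D := [set z : R * R | z.1 = z.2].
have mD : measurable D.
  have -> : D = (fun z : R * R => z.1 - z.2) @^-1` [set 0].
    by apply/seteqP; split=> z /=; [move->; rewrite subrr|move/eqP; rewrite subr_eq0 => /eqP].
  rewrite -[X in measurable X]setTI; apply: measurable_funB => //; exact: measurable_set1.
have -> : [set x | X x = Y x] = f @^-1` D by apply/seteqP; split=> x; rewrite /D /f /= => ->.
exists (f @^-1` D); split; [ | |by []].
  by rewrite -[X in measurable X]setTI; exact: (mf measurableT _ mD).
rewrite -[LHS]/(m mf D) -prodE //= /product_measure1.
rewrite integral0_eq // => a _ /=.
have -> : xsection D a = [set a].
  by apply/seteqP; split=> b; rewrite /xsection /= inE /D /= => ->.
exact: X0.
Qed.

Definition cylinder (T : Type) (R : realType) (I : eqType) (X : I -> T -> R) (s : seq I)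
    (B : I -> set R) : set T := [set x | forall v, v \in s -> B v (X v x)].

Lemma cylinder_cons (T : Type) (R : realType) (I : eqType) (X : I -> T -> R) (u : I)
    (s : seq I) (B : I -> set R) :
  cylinder X (u :: s) B = X u @^-1` B u `&` cylinder X s B.
Proof.
apply/seteqP; split=> x /=.
  by move=> h; split=> [|v vs]; apply: h; rewrite inE ?eqxx // vs orbT.
by move=> [hu hs] v; rewrite inE => /orP[/eqP->|/hs].
Qed.

Lemma preimage_cylinder (T : Type) (R : realType) (I : eqType) (X : I -> T -> R) (u : I)
    (A : set R) : X u @^-1` A = cylinder X [:: u] (fun=> A).
Proof.
rewrite cylinder_cons; apply/seteqP; split=> x; last by case.
by split=> // v.
Qed.

Lemma measurable_cylinder (d : measure_display) (T : measurableType d) (R : realType)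
    (I : eqType) (X : I -> {mfun T >-> R}) (s : seq I) (B : I -> set R) :
  (forall v, measurable (B v)) -> measurable (cylinder X s B).
Proof.
move=> mB; elim: s => [|u s IH].
  by have -> : cylinder X [::] B = setT by apply/seteqP; split=> x //= _ v.
by rewrite cylinder_cons; apply: measurableI => //; exact: measurable_funPTI.
Qed.

(** Keeping an arbitrary event on the remaining variables makes the induction on [s]
    possible: when [X u] is added to the sum, the pair formed by [X u] and
    the previous sum is independent of that event on rectangles, by the
    induction hypothesis for the event enlarged by a condition on [X u]. *)
Lemma lincomb_independent (d : measure_display) (T : measurableType d) (R : realType)
    (P : probability T R) (I : eqType) (D : pred I) (X : I -> {RV P >-> R}) (c : I -> R) :
  independent_on D X ->
  forall (s t : seq I) (B : I -> set R) (C : set R), uniq (s ++ t) -> {subset s ++ t <= D} ->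
    (forall v, measurable (B v)) -> measurable C ->
  P (cylinder X t B `&` lincomb X c s @^-1` C) =
    (P (cylinder X t B) * P (lincomb X c s @^-1` C))%E.
Proof.
move=> indep; elim=> [|u s IH] t B C ust stD mB mC.
  have E : lincomb X c [::] = cst 0 by apply/funext => x; rewrite /lincomb big_nil.
  rewrite E preimage_cst; case: ifP => _.
    by rewrite setIT probability_setT mule1.
  by rewrite setI0 measure0 mule0.
pose f x := (X u x, lincomb X c s x).
have mf : measurable_fun setT f.
  by apply/measurable_fun_pairP; split; exact: measurable_funPT.
pose Z := [set z : R * R | C (c u * z.1 + z.2)].
have mZ : measurable Z.
  rewrite -[X in measurable X]setTI; apply: (_ : measurable_fun setT _) => //.
  by apply: measurable_funD => //; apply: measurable_funM.
have -> : lincomb X c (u :: s) @^-1` C = f @^-1` Z.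
  by apply/seteqP; split=> x; rewrite /= /Z /f /lincomb big_cons.
have uP : uniq (s ++ u :: t) by rewrite -[u :: t]cat1s uniq_catCA.
have sub : {subset s ++ u :: t <= D}.
  by move=> v; rewrite mem_cat inE orbCA => h; apply: stD; rewrite inE mem_cat.
have tD : {subset u :: t <= D} by move=> v vt; apply: sub; rewrite mem_cat vt orbT.
have ut : uniq (u :: t) by move: uP; rewrite cat_uniq => /and3P[].
apply: independent_pair_event => //; first exact: measurable_cylinder.
move=> A A' mA mA'.
have rect : f @^-1` (A `*` A') = X u @^-1` A `&` lincomb X c s @^-1` A' by [].
(* The condition [X u \in A] is absorbed into the cylinder over [u :: t]. *)
pose B' v := if v == u then A else B v.
have mB' v : measurable (B' v) by rewrite /B'; case: ifP.
have cylE r : u \notin r -> cylinder X r B' = cylinder X r B.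
  move=> ur; have H v : v \in r -> B' v = B v.
    by rewrite /B'; case: eqP => // ->; rewrite (negPf ur).
  by apply/seteqP; split=> x h v vr; have := h v vr; rewrite H.
have cyl1 : X u @^-1` A `&` cylinder X t B = cylinder X (u :: t) B'.
  by rewrite cylinder_cons cylE ?/B' ?eqxx //; case/andP: ut.
have P1 : P (cylinder X (u :: t) B') = (P (X u @^-1` A) * P (cylinder X t B))%E.
  rewrite [LHS](indep _ _ ut tD mB') big_cons /B' eqxx; congr (_ * _)%E.
  rewrite -cylE; last by case/andP: ut.
  rewrite [RHS](indep t) //; first by case/andP: ut.
  by move=> v vt; apply: tD; rewrite inE vt orbT.
have P2 : P (X u @^-1` A `&` lincomb X c s @^-1` A') =
    (P (X u @^-1` A) * P (lincomb X c s @^-1` A'))%E.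
  rewrite (preimage_cylinder (fun i => X i) u A); apply: IH => //.
    move: uP; rewrite -cat_rcons cat_uniq => /and3P[us _ _].
    by rewrite cats1.
  by move=> v; rewrite mem_cat inE => h; apply: sub; rewrite mem_cat inE orbA h.
rewrite rect P2 setICA setIA cyl1 IH // P1 [X in (X * _)%E]muleC.
by rewrite muleA.
Qed.

Lemma sum_uniq_indicator (R : realType) (I : eqType) (r s : seq I) (F : I -> R) :
  uniq r -> uniq s -> {subset s <= r} ->
  \sum_(u <- s) F u = \sum_(u <- r) (u \in s)%:R * F u.
Proof.
move=> ur us sr; under [RHS]eq_bigr do rewrite mulr_natl mulrb.
rewrite -big_mkcond -[RHS]big_filter; apply: perm_big; apply: uniq_perm => //.
  exact: filter_uniq.
by move=> u; rewrite mem_filter andb_idr //; exact: sr.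
Qed.

(** Solving the equality for the weight of [v], which occurs in one sum only. *)
Lemma negligible_equal_sums (d : measure_display) (T : measurableType d) (R : realType)
    (P : probability T R) (I : eqType) (D : pred I) (X : I -> {RV P >-> R})
    (s1 s2 : seq I) (v : I) :
  independent_on D X -> (forall u, u \in D -> forall a, P (X u @^-1` [set a]) = 0%E) ->
  uniq s1 -> uniq s2 -> {subset s1 <= D} -> {subset s2 <= D} ->
  v \in s1 -> v \notin s2 ->
  P.-negligible [set x | \sum_(u <- s1) X u x = \sum_(u <- s2) X u x].
Proof.
move=> indep X0 u1 u2 D1 D2 v1 v2.
pose s := [seq u <- undup (s1 ++ s2) | u != v].
pose c u : R := (u \in s2)%:R - (u \in s1)%:R.
have vs : v \notin s by rewrite mem_filter eqxx.
have uvs : uniq (v :: s) by rewrite /= vs filter_uniq // undup_uniq.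
have mvs u : u \in s1 ++ s2 -> u \in v :: s.
  by rewrite inE mem_filter mem_undup => ->; rewrite andbT orbN.
have sD : {subset s ++ [:: v] <= D}.
  move=> u; rewrite mem_cat mem_filter mem_undup mem_cat inE.
  by move=> /orP[/andP[_ /orP[/D1|/D2]]|/eqP->]//; exact: D1.
have -> : [set x | \sum_(u <- s1) X u x = \sum_(u <- s2) X u x] =
    [set x | X v x = lincomb X c s x].
  have E x : \sum_(u <- s1) X u x - \sum_(u <- s2) X u x = X v x - lincomb X c s x.
    rewrite !(@sum_uniq_indicator _ _ (v :: s) _ (fun u => X u x)) //; first last.
    - by move=> u us; apply: mvs; rewrite mem_cat us.
    - by move=> u us; apply: mvs; rewrite mem_cat us orbT.
    rewrite !big_cons v1 (negPf v2) mul1r mul0r add0r -addrA; congr (_ + _).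
    rewrite /lincomb -sumrN -big_split -sumrN; apply: eq_bigr => u _ /=.
    by rewrite /c mulrBl opprB addrC.
  apply/seteqP; split=> x /= /eqP; rewrite -subr_eq0.
    by rewrite E subr_eq0 => /eqP.
  by rewrite -E subr_eq0 => /eqP.
apply: negligible_eq_independent_atomless; first exact/X0/D1.
move=> A B mA mB; rewrite (preimage_cylinder (fun i => X i) v A).
apply: (lincomb_independent c indep) => //.
by rewrite cats1 rcons_uniq.
Qed.

Lemma ae_forall_countable (d : measure_display) (T : measurableType d) (R : realType)
    (P : probability T R) (I : countType) (Q : I -> T -> Prop) :
  (forall i, {ae P, forall x, Q i x}) -> {ae P, forall x, forall i, Q i x}.
Proof.
move=> H.
have : {ae P, forall x, forall m, if unpickle m is Some i then Q i x else True}.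
  apply: ae_foralln => m; case: (unpickle m) => [i|]; first exact: H.
  by apply: aeW.
by apply: filterS => x h i; have := h (pickle i); rewrite pickleK.
Qed.

(** Countably many null events suffice, as there are countably many pairs of
    finite sequences of vertices. *)
Lemma ae_distinct_sums (d : measure_display) (T : measurableType d) (R : realType)
    (P : probability T R) (n : nat) (xi : vertex -> {RV P >-> R}) :
  independent_on (box n) xi ->
  (forall v, v \in box n -> forall a, P (xi v @^-1` [set a]) = 0%E) ->
  {ae P, forall x, distinct_sums n (fun v => xi v x)}.
Proof.
move=> indep atomless.
have H : {ae P, forall x, forall s : seq vertex * seq vertex,
    uniq s.1 -> uniq s.2 -> {subset s.1 <= box n} -> {subset s.2 <= box n} ->
    \sum_(v <- s.1) xi v x = \sum_(v <- s.2) xi v x -> s.1 =i s.2}.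
  apply: ae_forall_countable => -[s1 s2] /=.
  have [[u1 u2 b1 b2]|no] := pselect [/\ uniq s1, uniq s2, {subset s1 <= box n} &
    {subset s2 <= box n}]; last by apply: aeW => x *; case: no.
  have [e|/existsNP[v /eqP ne]] := pselect (s1 =i s2); first by apply: aeW.
  apply: (@negligibleS _ _ _ _ [set x | \sum_(u <- s1) xi u x = \sum_(u <- s2) xi u x]).
    move=> x /= h; apply: contrapT => ne'; apply: h => _ _ _ _ e; case: (ne' e).
  case: (boolP (v \in s1)) ne => v1; case: (boolP (v \in s2)) => v2 // _.
    exact: (negligible_equal_sums indep atomless u1 u2 b1 b2 v1 v2).
  have := negligible_equal_sums indep atomless u2 u1 b2 b1 v2 v1.
  by apply: negligibleS => x /= ->.
by apply: filterS H => x h s1 s2; exact: (h (s1, s2)).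
Qed.

Lemma ae_nonneg (d : measure_display) (T : measurableType d) (R : realType)
    (P : probability T R) (n : nat) (xi : vertex -> {RV P >-> R}) :
  (forall v, v \in box n -> P (xi v @^-1` [set a | 0 <= a]) = 1%E) ->
  {ae P, forall x, forall v, v \in box n -> 0 <= xi v x}.
Proof.
move=> H; apply: (@ae_forall_countable _ _ _ P (int * int)%type) => v.
case: (boolP (v \in box n)) => vb; last by apply: aeW.
have mA : measurable (xi v @^-1` [set a : R | 0 <= a]).
  apply: measurable_funPTI; rewrite (_ : [set a : R | 0 <= a] = `[0, +oo[%classic) //.
  by apply/seteqP; split=> a /=; rewrite in_itv /= andbT.
exists (~` (xi v @^-1` [set a : R | 0 <= a])); split.
- exact: measurableC.
- by rewrite probability_setC // H // subee.
- by move=> x /= h h'; apply: h.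
Qed.

Theorem proposition2p5 (R : realType) (d : measure_display)
    (T : measurableType d) (P : probability T R) (n : nat)
    (nu : probability R R)
    (nu_support : nu [set a : R | 0 <= a] = 1%E)
    (nu_continuous : forall a : R, nu [set a] = 0%E)
    (xi : vertex -> {RV P >-> R})
    (xi_independent : independent_on (box n) xi)
    (xi_law : forall v : vertex, v \in box n ->
      forall B : set R, measurable B -> distribution P (xi v) B = nu B)
    (k : nat) (k_ge1 : (1 <= k)%N) (k_lt_n : (k <= n - 1)%N) :
  {ae P, forall x : T,
    interlace (geodesic_watermelon n (fun v => xi v x) k)
              (geodesic_watermelon n (fun v => xi v x) k.+1)}.
Proof.
have atomless v : v \in box n -> forall a, P (xi v @^-1` [set a]) = 0%E.
  move=> vb a; rewrite -(nu_continuous a) -(xi_law v vb) //; exact: measurable_set1.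
have nonneg v : v \in box n -> P (xi v @^-1` [set a | 0 <= a]) = 1%E.
  move=> vb; rewrite -nu_support -(xi_law v vb) //.
  rewrite (_ : [set a : R | 0 <= a] = `[0, +oo[%classic) //.
  by apply/seteqP; split=> a /=; rewrite in_itv /= andbT.
have kn : (k < n)%N by lia.
apply: filterS2 (ae_nonneg nonneg) (ae_distinct_sums xi_independent atomless) => x.
exact: interlace_distinct_sums.
Qed.
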